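(* Let $G:\Sigma^{\mathbb{Z}}\to\Sigma^{\mathbb{Z}}$ be a reversible cellular automaton over a finite alphabet $\Sigma$, with block neighborhood $\mathcal{BN}\subseteq\mathbb{Z}$, and let $K_0=(G^{-1}\times\mathrm{id})\circ S_0\circ(G\times\mathrm{id})$ be its reversible update at cell $0$, viewed as a bijection of $\Sigma^{\{0,1\}\times\mathbb{Z}}$. Then the localization of $K_0$ is $$\mathrm{Loc}(K_0)=\bigl(\{0\}\times\mathcal{BN}\bigr)\cup\{(1,0)\}.$$
   Context: A reversible cellular automaton (RCA) over a finite alphabet $\Sigma$ is a bijection $G$ of the configuration space $\mathcal{C}_\Sigma=\Sigma^{\mathbb{Z}}$ that commutes with all translations and is causal (there is a finite $\mathcal{N}\subset\mathbb{Z}$ such that $G(c)_0$ depends only on $c|_{\mathcal{N}}$), and whose inverse $G^{-1}$ has the same properties. Two-layer configurations: $\mathcal{C}_{\Sigma^2}\simeq\mathcal{C}_\Sigma\times\mathcal{C}_\Sigma\simeq\Sigma^{\{0,1\}\times\mathbb{Z}}$. A configuration is a pair $(c,e)$, where $c$ is the first component (subcells $(0,j)$, $j\in\mathbb{Z}$) and $e$ is the second component (subcells $(1,j)$). In particular, $(1,0)$ denotes the subcell of the second component at cell $0$. For each cell $i$, $S_i$ is the map on $\mathcal{C}_{\Sigma^2}$ that exchanges the contents of subcells $(0,i)$ and $(1,i)$ and leaves all other subcells unchanged. The reversible update of $G$ at $i$ is $K_i=(G^{-1}\times\mathrm{id})\circ S_i\circ(G\times\mathrm{id})$. Localization: let $X$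 be a set of (sub)cells and $f$ a bijection of $\Sigma^X$. For $Y\subseteq X$, $f$ is localized upon $Y$ if $f=f_Y\times\mathrm{id}_{X\setminus Y}$ for some bijection $f_Y$ of $\Sigma^Y$ (identifying $\Sigma^X=\Sigma^Y\times\Sigma^{X\setminus Y}$). $\mathrm{Loc}(f)$ denotes the smallest (for inclusion) $Y\subseteq X$ upon which $f$ is localized. Semilocalizability: a bijection $F:A\times B\to C\times D$ is semilocalizable (with respect to these decompositions) if there are a set $E$ and bijections $g:A\to C\times E$ and $\tilde h:E\times B\to D$ such that $F=(\mathrm{id}_C\times\tilde h)\circ(g\times\mathrm{id}_B)$. Block neighborhood: $\mathcal{BN}$ is the smallest subset of $\mathbb{Z}$ such that $G$, viewed as a bijection $\Sigma^{\mathcal{BN}}\times\Sigma^{\mathbb{Z}\setminus\mathcal{BN}}\to\Sigma^{\{0\}}\times\Sigma^{\mathbb{Z}\setminus\{0\}}$, is semilocalizable. It is known that this smallest set exists and is finite.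
   Formalization: The alphabet is assumed to have at least two letters; over a one-letter alphabet the block neighborhood and Loc(K_0) are both empty, so the stated equality fails there. *)

(* Defs.v *)
From mathcomp Require Import all_boot all_order all_algebra.
From mathcomp Require Import all_classical.

Set Implicit Arguments.
Unset Strict Implicit.
Unset Printing Implicit Defensive.

Local Open Scope classical_set_scope.
Local Open Scope ring_scope.

Definition smallest_set (T : Type) (P : set T -> Prop) (Y : set T) : Prop :=
  P Y /\ forall Y', P Y' -> Y `<=` Y'.

Section Split.
Variables (S X : Type).

(* [split_on Y] and [glue_on] are the two directions of the identification of S^X
   with S^Y * S^(X \ Y). *)
Definition split_on (Y : set X) (c : X -> S) : (Y -> S) * (~` Y -> S) :=
  (sigL Y c, sigL (~` Y) c).

Definition glue_on (Y : set X) (p : (Y -> S) * (~` Y -> S)) : X -> S :=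
  fun x => match pselect (Y x) with
           | left xY => p.1 (SigSub (mem_set xY))
           | right xNY => p.2 (SigSub (mem_set (xNY : (~` Y) x)))
           end.

Lemma split_onK (Y : set X) : cancel (split_on Y) (@glue_on Y).
Proof. by move=> c; apply/funext => x; rewrite /glue_on; case: pselect. Qed.

Lemma glue_onK (Y : set X) : cancel (@glue_on Y) (split_on Y).
Proof.
case=> u v; congr pair; apply/funext => -[x xY];
  rewrite /sigL /glue_on /=; case: pselect => h.
- by congr u; apply: val_inj.
- by case: h; exact: set_mem xY.
- by case: (set_mem xY).
- by congr v; apply: val_inj.
Qed.

Definition localized (f : (X -> S) -> (X -> S)) (Y : set X) : Prop :=
  exists fY : (Y -> S) -> (Y -> S),
    bijective fY /\
    forall c, f c = glue_on (fY (split_on Y c).1, (split_on Y c).2).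

Definition is_Loc (f : (X -> S) -> (X -> S)) : set X -> Prop :=
  smallest_set (localized f).

End Split.

Definition semilocalizable (A B C D : Type) (F : A * B -> C * D) : Prop :=
  exists (E : Type) (g : A -> C * E) (h : E * B -> D),
    [/\ bijective g, bijective h
      & forall a b, F (a, b) = ((g a).1, h ((g a).2, b))].

Section RCA.
Variable S : Type.

Definition config : Type := int -> S.

Definition translate (k : int) (c : config) : config := fun i => c (i + k).

Definition translation_invariant (F : config -> config) : Prop :=
  forall k c, F (translate k c) = translate k (F c).

Definition causal (F : config -> config) : Prop :=
  exists N : set int, finite_set N /\
    forall c d : config, (forall i, N i -> c i = d i) -> F c 0 = F d 0.

Record rca := RCA {
  rca_fun :> config -> config;
  rca_inv : config -> config;
  rca_funK : cancel rca_fun rca_inv;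
  rca_invK : cancel rca_inv rca_fun;
  rca_fun_translation : translation_invariant rca_fun;
  rca_fun_causal : causal rca_fun;
  rca_inv_translation : translation_invariant rca_inv;
  rca_inv_causal : causal rca_inv
}.

Definition is_block_neighborhood (G : rca) : set int -> Prop :=
  smallest_set (fun Y : set int =>
    semilocalizable (fun p => split_on [set 0] (G (@glue_on S int Y p)))).

(* Two-layer configurations: layer 0 (the first component) is [false] and
   layer 1 (the second component) is [true]. *)
Definition config2 : Type := bool * int -> S.

Definition layer (b : bool) (w : config2) : config := fun i => w (b, i).

Definition pair_layers (c e : config) : config2 :=
  fun x => if x.1 then e x.2 else c x.2.

Definition on_first (F : config -> config) (w : config2) : config2 :=
  pair_layers (F (layer false w)) (layer true w).

Definition swap_at (i : int) (w : config2) : config2 :=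
  fun x => if x.2 == i then w (~~ x.1, x.2) else w x.

Definition reversible_update (G : rca) (i : int) : config2 -> config2 :=
  on_first (rca_inv G) \o swap_at i \o on_first G.

Lemma on_firstK (F F' : config -> config) :
  cancel F F' -> cancel (on_first F) (on_first F').
Proof.
move=> FK w; apply/funext => -[[] j] //=; rewrite /on_first /pair_layers /=.
by rewrite -[LHS]/(F' (F (layer false w)) j) FK.
Qed.

Lemma swap_atK i : involutive (swap_at i).
Proof.
by move=> w; apply/funext => -[b j]; rewrite /swap_at /=; case: eqP => //; rewrite negbK.
Qed.

Lemma reversible_update_bij (G : rca) i : bijective (reversible_update G i).
Proof.
exists (reversible_update G i) => w; rewrite /reversible_update /=;
  by rewrite (on_firstK (@rca_invK G)) swap_atK (on_firstK (@rca_funK G)).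
Qed.

End RCA.

(* Main.v *)
Require Import Defs.
From mathcomp Require Import all_boot all_order all_algebra.
From mathcomp Require Import all_classical.

Local Open Scope classical_set_scope.
Local Open Scope ring_scope.

(** Let [T c a] be the configuration whose image under [G] agrees with [a] at
    cell [0] and with [G c] elsewhere.  The update [K_0] sends [(c, e)] to
    [(T c e, e')], where [e'] is [e] with [G c 0] written at [0].  On the other
    hand [G] is semilocalizable at [Y] exactly when [G c 0] depends only on
    [c|Y], and [T] leaves [c] unchanged off [Y] and computes its values on [Y]
    from [c|Y] and [a 0]: the factor [E] is then the set of patterns on [Y]
    that produce one fixed symbol at cell [0], and [T] transports every pattern
    into it.  So the sets upon which [K_0] is localized are those that contain
    [(1, 0)] and whose trace on the first layer makes [G] semilocalizable. *)

Lemma sigL_eqP {S X : Type} (Y : set X) (c d : X -> S) :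
  sigL Y c = sigL Y d <-> forall x, Y x -> c x = d x.
Proof.
split=> [cd x Yx|cd]; first exact: (congr1 (@^~ (SigSub (mem_set Yx))) cd).
by apply/funext => -[x Yx]; apply/cd/set_mem.
Qed.

Lemma sigL_glue_on {S X : Type} (Y : set X) (u : Y -> S) (v : ~` Y -> S) :
  sigL Y (glue_on (u, v)) = u.
Proof. exact: (congr1 fst (glue_onK (u, v))). Qed.

Lemma sigLC_glue_on {S X : Type} (Y : set X) (u : Y -> S) (v : ~` Y -> S) :
  sigL (~` Y) (glue_on (u, v)) = v.
Proof. exact: (congr1 snd (glue_onK (u, v))). Qed.

Lemma glue_on_sigL {S X : Type} (Y : set X) (c : X -> S) :
  glue_on (sigL Y c, sigL (~` Y) c) = c.
Proof. exact: split_onK. Qed.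

Lemma eq_sigL {S X : Type} (Y : set X) (c d : X -> S) :
  sigL Y c = sigL Y d -> sigL (~` Y) c = sigL (~` Y) d -> c = d.
Proof. by move=> cdY cdNY; rewrite -(glue_on_sigL Y c) cdY cdNY glue_on_sigL. Qed.

(** Involutivity gives the bijectivity of the local map for free: the map that [f] induces on
    patterns over [Y] is its own inverse. The symbol [s] only pads a pattern to a full
    configuration. *)
Lemma involutive_localizedP {S X : Type} (s : S) {f : (X -> S) -> (X -> S)}
    (fK : involutive f) (Y : set X) :
  localized f Y <->
    (forall c, sigL (~` Y) (f c) = sigL (~` Y) c) /\
    (forall c d, sigL Y c = sigL Y d -> sigL Y (f c) = sigL Y (f d)).
Proof.
split=> [[fY [_ fE]]|[f_out f_in]].
  split=> [c|c d cd]; first by rewrite fE sigLC_glue_on.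
  by rewrite !fE !sigL_glue_on /= cd.
pose lift (u : Y -> S) := glue_on (u, fun=> s).
have lift_sigL c : sigL Y (lift (sigL Y c)) = sigL Y c by rewrite sigL_glue_on.
exists (fun u => sigL Y (f (lift u))); split=> [|c].
  by exists (fun u => sigL Y (f (lift u))) => u;
     rewrite (f_in _ _ (lift_sigL _)) fK sigL_glue_on.
rewrite -[LHS](glue_on_sigL Y) f_out /=.
by rewrite (f_in _ _ (lift_sigL c)).
Qed.

(** The map [T] of the overview, with [F], its inverse [F'] and a set [P] in place of [G], its
    inverse and cell [0]. *)
Definition overwrite {S X Z : Type} (P : set Z) (F : (X -> S) -> (Z -> S))
    (F' : (Z -> S) -> (X -> S)) (c : X -> S) (a : Z -> S) : X -> S :=
  F' (glue_on (sigL P a, sigL (~` P) (F c))).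

Section Overwrite.
Context {S X Z : Type} {F : (X -> S) -> (Z -> S)} {F' : (Z -> S) -> (X -> S)}.
Hypotheses (FK : cancel F F') (F'K : cancel F' F).
Variable P : set Z.

Let T := overwrite P F F'.

Lemma overwrite_in c a : sigL P (F (T c a)) = sigL P a.
Proof. by rewrite F'K sigL_glue_on. Qed.

Lemma overwrite_out c a : sigL (~` P) (F (T c a)) = sigL (~` P) (F c).
Proof. by rewrite F'K sigLC_glue_on. Qed.

Lemma overwriteK c a b : sigL P (F c) = sigL P b -> T (T c a) b = c.
Proof.
move=> cb; apply/(can_inj FK)/(eq_sigL P); first by rewrite overwrite_in.
by rewrite !overwrite_out.
Qed.

Lemma semilocalizable_overwriteP (c0 : X -> S) (Y : set X) :
  semilocalizable (fun p => split_on P (F (@glue_on S X Y p))) <->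
    [/\ forall c d, sigL Y c = sigL Y d -> sigL P (F c) = sigL P (F d),
        forall c a, sigL (~` Y) (T c a) = sigL (~` Y) c
      & forall c d a, sigL Y c = sigL Y d -> sigL Y (T c a) = sigL Y (T d a)].
Proof.
split=> [[E [g [h [[g' gK g'K] _ FE]]]]|[F_in T_out T_in]].
  have F_P c : sigL P (F c) = (g (sigL Y c)).1.
    by have /(congr1 fst) := FE (sigL Y c) (sigL (~` Y) c); rewrite glue_on_sigL.
  have F_NP c : sigL (~` P) (F c) = h ((g (sigL Y c)).2, sigL (~` Y) c).
    by have /(congr1 snd) := FE (sigL Y c) (sigL (~` Y) c); rewrite glue_on_sigL.
  (* Overwriting replaces the [P]-output of the first block and keeps its [E]-output, so it amounts
     to applying [g'] on [Y]. *)
  have TE c a : T c a =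
      glue_on (g' (sigL P a, (g (sigL Y c)).2), sigL (~` Y) c).
    apply/(can_inj FK)/(eq_sigL P).
      by rewrite overwrite_in F_P sigL_glue_on g'K.
    by rewrite overwrite_out !F_NP sigL_glue_on sigLC_glue_on g'K.
  split=> [c d cd|c a|c d a cd]; first by rewrite !F_P cd.
    by rewrite TE sigLC_glue_on.
  by rewrite !TE !sigL_glue_on cd.
pose lift (u : Y -> S) := glue_on (u, sigL (~` Y) c0).
pose lift_P (p : P -> S) := glue_on (p, sigL (~` P) (F c0)).
have lift_sigL c : sigL Y (lift (sigL Y c)) = sigL Y c by rewrite sigL_glue_on.
(* [F c0] supplies the fixed pattern on [P]. Padding by [c0] in [lift] is harmless, since by [F_in]
   this pattern depends on [u] alone. *)
pose E := {u : Y -> S | sigL P (F (lift u)) = sigL P (F c0)}.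
have norm_subproof c :
    sigL P (F (lift (sigL Y (T c (F c0))))) = sigL P (F c0).
  by rewrite (F_in _ _ (lift_sigL _)) overwrite_in.
pose norm c : E := exist _ _ (norm_subproof c).
have E_inj : injective (fun e : E => sval e) by move=> ? ? /eq_sig_hprop; apply.
exists E, (fun u => (sigL P (F (lift u)), norm (lift u))),
  (fun eb => sigL (~` P) (F (glue_on (sval eb.1, eb.2)))); split.
(* The first block is inverted by writing the recorded pattern back on [P], which undoes the
   normalization by [overwriteK]. *)
- exists (fun pe => sigL Y (T (lift (sval pe.2)) (lift_P pe.1))).
    move=> u /=; rewrite (T_in _ _ _ (lift_sigL _)) overwriteK ?sigL_glue_on //.
  case=> p [u uP] /=; congr pair.
    by rewrite (F_in _ _ (lift_sigL _)) overwrite_in sigL_glue_on.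
  apply: E_inj => /=.
  by rewrite (T_in _ _ _ (lift_sigL _)) overwriteK // sigL_glue_on.
- have glue_E (e : E) b : sigL P (F (glue_on (sval e, b))) = sigL P (F c0).
    by apply: etrans (svalP e); apply: F_in; rewrite !sigL_glue_on.
  (* The second block is inverted by completing [d] with the fixed pattern on [P] and pulling back
     through [F]. *)
  pose c1 (d : ~` P -> S) := F' (glue_on (sigL P (F c0), d)).
  have c1_P d : sigL P (F (lift (sigL Y (c1 d)))) = sigL P (F c0).
    by rewrite (F_in _ _ (lift_sigL _)) F'K sigL_glue_on.
  exists (fun d => (exist _ _ (c1_P d) : E, sigL (~` Y) (c1 d))).
    case=> e b /=.
    have c1E : c1 (sigL (~` P) (F (glue_on (sval e, b)))) = glue_on (sval e, b).
      apply/(can_inj FK)/(eq_sigL P); first by rewrite F'K sigL_glue_on glue_E.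
      by rewrite F'K sigLC_glue_on.
    congr pair; first by apply: E_inj; rewrite /= c1E sigL_glue_on.
    by rewrite c1E sigLC_glue_on.
  by move=> d /=; rewrite glue_on_sigL F'K sigLC_glue_on.
- move=> u b; rewrite /split_on /=.
  have lift_u : sigL Y (lift u) = sigL Y (glue_on (u, b)) by rewrite !sigL_glue_on.
  congr pair; first by apply: F_in.
  (* Since [T] fixes everything off [Y], normalizing the pattern on [Y] normalizes the whole
     configuration, and this leaves the image off [P] intact. *)
  have -> : glue_on (sigL Y (T (lift u) (F c0)), b) = T (glue_on (u, b)) (F c0).
    apply: (eq_sigL Y); first by rewrite sigL_glue_on (T_in _ _ _ lift_u).
    by rewrite T_out !sigLC_glue_on.
  by rewrite overwrite_out.
Qed.

End Overwrite.

Lemma reversible_update_involutive {S : Type} (G : rca S) i :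
  involutive (reversible_update G i).
Proof.
move=> w; rewrite /reversible_update /=.
by rewrite (on_firstK (@rca_invK _ G)) swap_atK (on_firstK (@rca_funK _ G)).
Qed.

Lemma reversible_update_first {S : Type} (G : rca S) i (w : config2 S) j :
  reversible_update G i w (false, j) =
    overwrite [set i] G (rca_inv G) (layer false w) (layer true w) j.
Proof.
rewrite /reversible_update /= /on_first /pair_layers /= /overwrite.
congr (rca_inv G _ j); apply: (eq_sigL [set i]).
  by rewrite sigL_glue_on; apply/sigL_eqP => k ->; rewrite /layer /swap_at /= eqxx.
rewrite sigLC_glue_on; apply/sigL_eqP => k /eqP/negbTE ki.
by rewrite /layer /swap_at /= ki.
Qed.

Lemma reversible_update_second {S : Type} (G : rca S) i (w : config2 S) j :
  reversible_update G i w (true, j) =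
    if j == i then G (layer false w) j else w (true, j).
Proof. by []. Qed.

Theorem proposition1 (S : finType) (S_gt1 : (1 < #|S|)%N) (G : rca S)
    (BN : set int) (BN_def : is_block_neighborhood G BN) :
  is_Loc (reversible_update G 0) (([set false] `*` BN) `|` [set (true, 0)]).
Proof.
have /card_gt1P[s [t [_ _ st]]] := S_gt1.
have semilocP :=
  semilocalizable_overwriteP (@rca_funK _ G) (@rca_invK _ G) [set 0] (fun=> s).
have locP := involutive_localizedP s (reversible_update_involutive G 0).
have [/semilocP[G_in T_out T_in] BN_min] := BN_def.
split.
  apply/locP; split=> [w|w w' /sigL_eqP ww'].
    apply/sigL_eqP => -[[] j] jY.
      by rewrite reversible_update_second; case: eqP => // j0; case: jY; right; rewrite j0.
    rewrite reversible_update_first.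
    by apply: ((sigL_eqP _ _ _).1 (T_out _ _)) => BNj; apply: jY; left.
  have ww'BN : sigL BN (layer false w) = sigL BN (layer false w').
    by apply/sigL_eqP => j BNj; apply: ww'; left.
  apply/sigL_eqP => -[b j] [[/= -> BNj]|[-> ->]]; last first.
    rewrite !reversible_update_second eqxx.
    exact: ((sigL_eqP _ _ _).1 (G_in _ _ ww'BN)).
  rewrite !reversible_update_first.
  (* Only the symbol at [(true, 0)] is read from the second layer, and there [w] and [w'] agree. *)
  have -> : overwrite [set 0] G (rca_inv G) (layer false w') (layer true w') =
            overwrite [set 0] G (rca_inv G) (layer false w') (layer true w).
    congr (rca_inv G (glue_on (_, _))); apply/sigL_eqP => _ ->.
    by apply/esym/ww'; right.
  exact: ((sigL_eqP _ _ _).1 (T_in _ _ _ ww'BN)).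
move=> Y /locP[K_out K_in].
have Yt0 : Y (true, 0).
  apply: contrapT => Yt0.
  (* On this [w] the update turns the [s] at [(true, 0)] into [t], a different symbol. *)
  pose w := pair_layers (rca_inv G (fun=> t)) (fun=> s).
  have := (sigL_eqP _ _ _).1 (K_out w) _ Yt0.
  rewrite reversible_update_second eqxx -[layer false w]/(rca_inv G (fun=> t)).
  by rewrite rca_invK => ts; case/eqP: st; exact: esym ts.
pose V := [set i | Y (false, i)].
(* With a common second layer [e], agreement on [V] is already agreement on all of [Y]. *)
have K_eq (c d e : config S) : sigL V c = sigL V d -> forall x, Y x ->
    reversible_update G 0 (pair_layers c e) x =
    reversible_update G 0 (pair_layers d e) x.
  move=> /sigL_eqP cd; apply/sigL_eqP/K_in/sigL_eqP => -[[] j] //=.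
  exact: cd.
suff /BN_min BN_V : semilocalizable (fun p => split_on [set 0] (G (@glue_on S int V p))).
  by move=> [b j] [[/= -> /BN_V]|->].
apply/semilocP; split=> [c d cd|c a|c d a cd].
(* The symbol [G c 0] is what the update writes at [(true, 0)], a subcell of [Y]. *)
- apply/sigL_eqP => _ ->; have := K_eq _ _ c cd _ Yt0.
  by rewrite !reversible_update_second eqxx.
- apply/sigL_eqP => j Vj.
  have := (sigL_eqP _ _ _).1 (K_out (pair_layers c a)) (false, j) Vj.
  by rewrite reversible_update_first.
- apply/sigL_eqP => j Vj; have := K_eq _ _ a cd _ Vj.
  by rewrite !reversible_update_first.
Qed.
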